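(* Every hypercircuit is partition-connected: if $H=(V,E)$ is a hypercircuit, then for every partition $\mathcal P$ of $V$ into nonempty parts, the number $N(\mathcal P)$ of edges of $E$ having vertices in at least two parts of $\mathcal P$ satisfies $N(\mathcal P)\ge|\mathcal P|-1$.
   Context: A hypergraph $H=(V,E)$ has a finite vertex set and a set $E$ of nonempty subsets of $V$. For $X\subseteq V$, $\Gamma(X)$ is the set of edges $e\in E$ with $e\cap X\ne\emptyset$. $H$ is a hypercircuit if $|V|=|E|$ and $|\Gamma(X)|\ge|X|+1$ for every nonempty proper subset $X\subsetneq V$. A hypergraph is partition-connected if every partition $\mathcal P$ of its vertex set satisfies $N(\mathcal P)\ge|\mathcal P|-1$. *)

(* Defs.v *)
From mathcomp Require Import all_boot.

Set Implicit Arguments.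
Unset Strict Implicit.
Unset Printing Implicit Defensive.

(* Edges form a set, so there are no parallel edges; an edge may be a single
   vertex. *)
Record hypergraph := Hypergraph {
  vertex : finType;
  edges : {set {set vertex}};
  edges_nonempty : forall e : {set vertex}, e \in edges -> e != set0
}.

Definition Gamma (H : hypergraph) (X : {set vertex H}) : {set {set vertex H}} :=
  [set e in edges H | e :&: X != set0].

Definition hypercircuit (H : hypergraph) : Prop :=
  #|vertex H| = #|edges H| /\
  forall X : {set vertex H}, X != set0 -> X \proper [set: vertex H] ->
    #|X| + 1 <= #|Gamma X|.

Definition crossing_edges (H : hypergraph) (P : {set {set vertex H}}) :
    {set {set vertex H}} :=
  [set e in edges H | 2 <= #|[set A in P | e :&: A != set0]|].

(* [partition] requires the parts to be nonempty. The truncated subtraction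
   only differs from the integer one when P is empty, where the inequality
   holds under both readings. *)
Definition partition_connected (H : hypergraph) : Prop :=
  forall P : {set {set vertex H}}, partition P [set: vertex H] ->
    #|P| - 1 <= #|crossing_edges P|.

(* Main.v *)
Require Import Defs.
From mathcomp Require Import all_boot.

Set Implicit Arguments.
Unset Strict Implicit.
Unset Printing Implicit Defensive.

(** In a hypercircuit, the edges inside a nonempty proper subset [A] are those
    outside [Gamma (~: A)], so there are at most [#|A| - 1] of them.  Summing
    over the parts of [P], at most [#|V| - #|P| = #|E| - #|P|] edges do not
    cross. *)

Lemma leq_card_bigcup (T I : finType) (P : {set I}) (F : I -> {set T}) :
  #|\bigcup_(i in P) F i| <= \sum_(i in P) #|F i|.
Proof.
elim/big_rec2: _ => [|i n A _ leAn]; first by rewrite cards0.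
by rewrite (leq_trans (leq_card_setU _ _)) // leq_add2l.
Qed.

Definition inner_edges (H : hypergraph) (A : {set vertex H}) :
    {set {set vertex H}} :=
  [set e in edges H | e \subset A].

Lemma card_inner_edges (H : hypergraph) (A : {set vertex H}) :
  #|inner_edges A| + #|Gamma (~: A)| = #|edges H|.
Proof.
have <- : edges H :\: Gamma (~: A) = inner_edges A.
  apply/setP=> e; rewrite !inE -setDE setD_eq0.
  by case: (e \in edges H); rewrite ?andbF //= negbK andbT.
rewrite addnC -[RHS](cardsID (Gamma (~: A))) (setIidPr _) //.
by apply/subsetP=> e; rewrite inE => /andP[].
Qed.

Lemma hypercircuit_card_inner_edges (H : hypergraph) (A : {set vertex H}) :
  hypercircuit H -> A != set0 -> A != setT -> #|inner_edges A| < #|A|.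
Proof.
move=> [cardVE expand] A0 AT.
have AC0 : ~: A != set0 by rewrite -setCT (inj_eq (@setC_inj _)).
have ACT : ~: A \proper setT by rewrite properT -setC0 (inj_eq (@setC_inj _)).
have := expand _ AC0 ACT.
(* Adding [#|inner_edges A|] to both sides turns the right one into [#|edges H|], which is
   [#|A| + #|~: A|]; cancelling [#|~: A|] leaves the strict bound. *)
rewrite -(leq_add2l #|inner_edges A|) card_inner_edges -cardVE -(cardsC A).
by rewrite addn1 addnS -addSn leq_add2r.
Qed.

(** A non-crossing edge meets at most one part. Being nonempty, it has a vertex in some part [A];
    the part of any other of its vertices is also met, hence equals [A]. *)
Lemma edges_sub_crossing_inner (H : hypergraph) (P : {set {set vertex H}}) :
  partition P [set: vertex H] ->
  edges H \subset crossing_edges P :|: \bigcup_(A in P) inner_edges A.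
Proof.
case/and3P=> /eqP coverP _ _; apply/subsetP=> e eE.
rewrite !inE eE /=; case: leqP => //= le1.
have meets v : v \in e -> exists2 A, A \in [set A in P | e :&: A != set0] & v \in A.
  move=> ve; have: v \in cover P by rewrite coverP inE.
  case/bigcupP=> A AP vA; exists A => //.
  by rewrite inE AP; apply/set0Pn; exists v; rewrite inE ve.
have /set0Pn[v /meets[A AP _]] := edges_nonempty eE.
apply/bigcupP; exists A; first by move: AP; rewrite inE => /andP[].
rewrite inE eE; apply/subsetP=> w /meets[B BP].
by rewrite (card_le1_eqP le1 B A BP AP).
Qed.

Theorem theorem13 (H : hypergraph) (hH : hypercircuit H) :
  partition_connected H.
Proof.
(* With at most one part, [#|P| - 1] is 0. *)
move=> P partP; have [/eqP -> // | lt1P] := leqP #|P| 1.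
have /and3P[_ trivP P0] := partP.
(* A part equal to the whole vertex set would force any other part, disjoint from it, to be
   empty. *)
have properP A : A \in P -> A != setT.
  move=> AP; apply: contraTneq lt1P => AT; rewrite -leqNgt.
  apply/card_le1_eqP; suff eqA B : B \in P -> B = A by move=> B C /eqA-> /eqA->.
  move=> BP; apply/eqP; apply: contraT => neBA.
  have := trivIsetP trivP B A BP AP neBA.
  rewrite -setI_eq0 AT setIT => /eqP B0.
  by rewrite -B0 BP in P0.
have inner : #|\bigcup_(A in P) inner_edges A| + #|P| <= #|vertex H|.
  (* [#|P|] becomes a sum of ones over the parts, each absorbed by the strict inequality for its
     part. *)
  rewrite -cardsT (card_partition partP) -(sum1_card (mem P)).
  apply: leq_trans (leq_add (leq_card_bigcup _ _) (leqnn _)) _.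
  rewrite -big_split /= leq_sum // => A AP; rewrite addn1.
  apply: hypercircuit_card_inner_edges => //; last exact: properP.
  by apply: contraNneq P0 => <-.
(* With at least two parts the stronger bound [#|P| <= #|crossing_edges P|] holds. *)
apply: leq_trans (leq_subr _ _) _.
rewrite -(leq_add2l #|\bigcup_(A in P) inner_edges A|) (leq_trans inner) //.
rewrite hH.1 addnC (leq_trans (subset_leq_card (edges_sub_crossing_inner partP))) //.
exact: leq_card_setU.
Qed.
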